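(* Let $n\geq 1$ and let $G_1,\ldots,G_n$ be complete graphs with $|V(G_i)|\geq 2$ for each $1\leq i\leq n$. Let $G$ be the disjoint union of $G_1,\ldots,G_n$, and let $1\leq r\leq n$. Let $k$ be an integer with $2\leq k\leq \min_{1\leq i\leq n}|V(G_i)|$, and let $\mathcal{A}_1,\ldots,\mathcal{A}_k\subseteq \mathcal{J}^r(G)$ be cross-intersecting families. Then $$\sum_{i=1}^k|\mathcal{A}_i|\leq |\mathcal{J}^{r}(G)|.$$ This bound is best possible: it is attained by $\mathcal{A}_1=\mathcal{J}^r(G)$ and $\mathcal{A}_2=\cdots=\mathcal{A}_k=\emptyset$.
   Context: For a graph $G$, $\mathcal{J}^r(G)$ denotes the family of all independent vertex sets of size $r$ in $G$. A collection of families $\mathcal{A}_1,\ldots,\mathcal{A}_k$ is cross-intersecting if for all $i\neq j$ in $\{1,\ldots,k\}$, every $A\in\mathcal{A}_i$ and $B\in\mathcal{A}_j$ satisfy $A\cap B\neq\emptyset$. The individual families need not be non-empty or intersecting, and a set may lie in several families. *)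

(* Defs.v *)
From mathcomp Require Import all_boot.

Set Implicit Arguments.
Unset Strict Implicit.
Unset Printing Implicit Defensive.

Record sgraph := SGraph {
  vertex :> finType;
  edge : rel vertex;
  edge_sym : symmetric edge;
  edge_irrefl : irreflexive edge }.

Definition complete (G : sgraph) : Prop :=
  forall x y : G, x != y -> edge x y.

Section DisjointUnion.
Variables (I : finType) (G : I -> sgraph).

(* [tagged_as x y] is the second component of [y], cast to the component of
   [x]; the cast is meaningful because of the guard [tag x == tag y]. *)
Definition dunion_edge : rel {i : I & G i} :=
  fun x y => (tag x == tag y) && edge (tagged x) (tagged_as x y).

Lemma dunion_edge_sym : symmetric dunion_edge.
Proof.
case=> i x [j y]; rewrite /dunion_edge /= eq_sym.
case: eqP => //= eq_ji; case: i / eq_ji x => x.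
by rewrite !tagged_asE edge_sym.
Qed.

Lemma dunion_edge_irrefl : irreflexive dunion_edge.
Proof. by case=> i x; rewrite /dunion_edge eqxx tagged_asE edge_irrefl. Qed.

Definition dunion : sgraph := SGraph dunion_edge_sym dunion_edge_irrefl.

End DisjointUnion.

Definition independent (G : sgraph) (S : {set G}) : bool :=
  [forall x in S, forall y in S, ~~ edge x y].

Definition indep_sets (G : sgraph) (r : nat) : {set {set G}} :=
  [set S : {set G} | independent S & #|S| == r].

Definition cross_intersecting (T : finType) (k : nat)
    (A : 'I_k -> {set {set T}}) : Prop :=
  forall i j : 'I_k, i != j ->
  forall B C : {set T}, B \in A i -> C \in A j -> B :&: C != set0.

(* Main.v *)
(** Cyclically permute the vertices inside each complete graph. Since an
    independent set meets every component at most once and every component has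
    at least [k] vertices, the first [k] shifts of a nonempty independent set
    are pairwise disjoint. Among these [k] shifts there are at most [k]
    incidences with the cross-intersecting families: two incidences with
    distinct families must involve the same shift. Averaging over all
    independent sets of size [r] gives the bound. *)
Require Import Defs.
From mathcomp Require Import all_boot.

(** Either every row has at most one incidence, or some row [i] has two, in distinct columns. An
    incidence in any other row would have to share its column with both, so row [i], with its [k]
    columns, holds them all. *)
Lemma sum_incidence_le (k : nat) (e : 'I_k -> pred 'I_k) :
    (forall i i' j j', e i j -> e i' j' -> i != i' -> j = j') ->
  \sum_(i < k) \sum_(j < k) e i j <= k.
Proof.
move=> eP.
have rowE i : \sum_(j < k) e i j = #|e i|.
  rewrite -sum1_card [RHS]big_mkcond; apply: eq_bigr => j _.
  by rewrite unfold_in; case: (e i j).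
under eq_bigr do rewrite rowE.
have [/forallP row_le1|] := boolP [forall i, #|e i| <= 1].
  rewrite -[leqRHS]card_ord -sum1_card; exact: leq_sum.
rewrite negb_forall => /existsP[i]; rewrite -ltnNge.
case/card_gt1P=> j [j'] [eij eij' neq_jj'].
rewrite (bigD1 i) //= big1 ?addn0 => [|i' neq_i'i].
  by rewrite -[leqRHS]card_ord max_card.
apply: eq_card0 => j''; rewrite unfold_in; apply/negP => ei'j''.
case/eqP: neq_jj'.
by rewrite -(eP _ _ _ _ ei'j'' eij neq_i'i) (eP _ _ _ _ ei'j'' eij' neq_i'i).
Qed.

Section CyclicShift.
Variables (I : finType) (G : I -> sgraph).

Definition shift (x : dunion G) : dunion G :=
  Tagged G (next (enum (G (tag x))) (tagged x)).

Lemma iter_shift m (x : dunion G) :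
  iter m shift x = Tagged G (iter m (next (enum (G (tag x)))) (tagged x)).
Proof. by elim: m => [|m /= ->] //; case: x. Qed.

Lemma tag_iter_shift m x : tag (iter m shift x) = tag x.
Proof. by rewrite iter_shift. Qed.

Lemma iter_shift_inj m : injective (iter m shift).
Proof.
have shift_inj : injective shift.
  move=> [i x] [j y] eq_xy; have /= eq_ij := congr1 tag eq_xy.
  case: j / eq_ij y eq_xy => y /eqP; rewrite /shift /= eq_Tagged /= => /eqP.
  by move/(can_inj (prev_next (enum_uniq _))) => ->.
by elim: m => // m IHm x y /= /shift_inj/IHm.
Qed.

(** The enumeration of a component is a single cycle under [next], so every orbit has the full
    length [#|G (tag x)|], and [findex] recovers any exponent below it. *)
Lemma iter_shift_index a b x :
  a < #|G (tag x)| -> b < #|G (tag x)| ->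
  iter a shift x = iter b shift x -> a = b.
Proof.
case: x => i x /= lt_a lt_b; rewrite !iter_shift /= => /eqP.
rewrite eq_Tagged /= => /eqP eq_ab.
have orderE : order (next (enum (G i))) x = #|G i|.
  rewrite (order_cycle (cycle_next (enum_uniq _)) (enum_uniq _)) ?mem_enum //.
  by rewrite cardE.
by rewrite -(findex_iter (f := next (enum (G i))) (x := x) (i := a)) ?orderE //
  eq_ab findex_iter ?orderE.
Qed.

Hypothesis G_complete : forall i, complete (G i).

(** Edges join exactly the pairs of distinct vertices with equal tags, by completeness. *)
Lemma independent_dunionP (S : {set dunion G}) :
  reflect {in S &, injective (@tag I G)} (independent S).
Proof.
apply: (iffP forall_inP) => [indS x y xS yS | tag_inj x xS].
  move: (forall_inP (indS x xS) y yS).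
  case: x xS => i x xS; case: y yS => j y yS /= nxy eq_ij.
  case: j / eq_ij y yS nxy => y yS; rewrite /= /dunion_edge eqxx tagged_asE /=.
  by move=> nxy; congr Tagged; apply/eqP; apply: contraR nxy; apply: G_complete.
apply/forall_inP => y yS; apply/negP => exy.
have /tag_inj-/(_ xS yS) eq_xy : tag x = tag y by case/andP: exy => /eqP.
by rewrite eq_xy edge_irrefl in exy.
Qed.

Lemma indep_sets_iter_shift r m (S : {set dunion G}) :
  (iter m shift @: S \in indep_sets (dunion G) r) =
  (S \in indep_sets (dunion G) r).
Proof.
rewrite !inE card_imset; last exact: iter_shift_inj.
congr (_ && _); apply/independent_dunionP/independent_dunionP => tag_inj.
  move=> x y xS yS eq_xy; apply: (@iter_shift_inj m); apply: tag_inj.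
  - exact: imset_f.
  - exact: imset_f.
  - by rewrite !tag_iter_shift.
move=> _ _ /imsetP[x xS ->] /imsetP[y yS ->]; rewrite !tag_iter_shift.
by move/(tag_inj _ _ xS yS) => ->.
Qed.

Lemma disjoint_iter_shift (S : {set dunion G}) k a b :
    (forall i, k <= #|G i|) -> independent S -> a < k -> b < k -> a != b ->
  iter a shift @: S :&: iter b shift @: S = set0.
Proof.
move=> k_le /independent_dunionP tag_inj lt_ak lt_bk neq_ab.
apply/setP => z; rewrite !inE; apply/negP.
case/andP=> /imsetP[x xS ->] /imsetP[y yS eq_xy].
have eq_x_y : x = y.
  by apply: tag_inj => //; rewrite -(tag_iter_shift a) eq_xy tag_iter_shift.
case/eqP: neq_ab; move: eq_xy; rewrite -eq_x_y.
by apply: iter_shift_index; apply: leq_trans (k_le _).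
Qed.

Lemma sum_card_cross_intersecting r k (A : 'I_k -> {set {set dunion G}}) :
    (forall i, k <= #|G i|) ->
    (forall i, A i \subset indep_sets (dunion G) r) ->
    cross_intersecting A ->
  \sum_(i < k) #|A i| <= #|indep_sets (dunion G) r|.
Proof.
(* The case [k = 0] is set apart because the final count cancels a factor [k]. *)
move=> k_le A_sub A_cross; case: (posnP k) => [k0|k_gt0].
  by rewrite big1 // => i; have := ltn_ord i; rewrite {2}k0.
set J := indep_sets _ r in A_sub *.
pose inc (S : {set dunion G}) i (j : 'I_k) := iter j shift @: S \in A i.
have inc_le S : S \in J -> \sum_(i < k) \sum_(j < k) inc S i j <= k.
  move=> SJ; apply: sum_incidence_le => i i' j j' Aij Ai'j' neq_ii'.
  have /andP[indS _] : independent S && (#|S| == r) by rewrite inE in SJ.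
  (* Different shifts of [S] are disjoint, which would contradict cross-intersection. *)
  apply/eqP; apply: contraT => neq_jj'.
  have := A_cross _ _ neq_ii' _ _ Aij Ai'j'.
  by rewrite (disjoint_iter_shift _ _ _ _ k_le) ?eqxx.
(* Taking images under a fixed shift permutes the vertex sets, so the preimage of [A i] has the size
   of [A i]; it lies in [J] by shift invariance. *)
have sum_inc i j : \sum_(S in J) inc S i j = #|A i|.
  have imset_bij : bijective (fun S : {set dunion G} => iter j shift @: S).
    exact/injF_bij/imset_inj/iter_shift_inj.
  rewrite -(on_card_preimset (onW_bij _ imset_bij)) -sum1_card.
  rewrite big_mkcond [RHS]big_mkcond; apply: eq_bigr => S _.
  rewrite [in RHS]inE /inc /=.
  case: (boolP (_ \in A i)) => [/(subsetP (A_sub i))|]; last by case: ifP.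
  by rewrite indep_sets_iter_shift => ->.
(* Double counting: summed over [S] first, the incidences number [k] times the left-hand side; each
   [S] contributes at most [k]. *)
rewrite -(leq_pmul2l k_gt0) [leqRHS]mulnC -sum_nat_const.
apply: (@leq_trans (\sum_(S in J) \sum_(i < k) \sum_(j < k) inc S i j)).
  rewrite exchange_big big_distrr /=; apply: leq_sum => i _.
  rewrite exchange_big /=; under eq_bigr do rewrite sum_inc.
  by rewrite sum_nat_const card_ord.
exact: leq_sum.
Qed.

End CyclicShift.

Theorem theorem1p4 (n : nat) (Gs : 'I_n -> sgraph) (r k : nat)
    (n_ge1 : 1 <= n)
    (Gs_complete : forall i : 'I_n, complete (Gs i))
    (Gs_card : forall i : 'I_n, 2 <= #|Gs i|)
    (r_bounds : 1 <= r <= n)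
    (k_ge2 : 2 <= k)
    (k_le : forall i : 'I_n, k <= #|Gs i|) :
  (forall A : 'I_k -> {set {set dunion Gs}},
     (forall i : 'I_k, A i \subset indep_sets (dunion Gs) r) ->
     cross_intersecting A ->
     \sum_(i < k) #|A i| <= #|indep_sets (dunion Gs) r|) /\
  (let A0 : 'I_k -> {set {set dunion Gs}} :=
     fun i => if val i == 0 then indep_sets (dunion Gs) r else set0 in
   (forall i : 'I_k, A0 i \subset indep_sets (dunion Gs) r) /\
   cross_intersecting A0 /\
   \sum_(i < k) #|A0 i| = #|indep_sets (dunion Gs) r|).
Proof.
split=> [A | A0]; first exact: sum_card_cross_intersecting.
split; first by move=> i; rewrite /A0; case: ifP => // _; apply: sub0set.
split.
  move=> i j neq_ij B C; rewrite /A0.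
  case: eqP => [i0 _|]; last by rewrite inE.
  case: eqP => [j0|]; last by rewrite inE.
  by case/eqP: neq_ij; apply: val_inj; rewrite /= i0 j0.
(* [ltnW k_ge2] serves as a proof of [0 < k], so the term split off is that of index 0. *)
rewrite (bigD1 (Ordinal (ltnW k_ge2))) //= big1 ?addn0 // => i neq_i0.
rewrite /A0; case: eqP => [i0|_]; last exact: cards0.
by case/eqP: neq_i0; apply: val_inj.
Qed.
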